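(* Let $f:\mathbb{R}^d\to\mathbb{R}$ be an $L$-smooth function with $L>0$ (not assumed convex), bounded below, and let $f_*=\inf_{x}f(x)$. Suppose the stochastic gradient satisfies $\mathbb{E}[\mathcal G(x;\xi)]=\nabla f(x)$ and $\mathbb{E}[\|\mathcal G(x;\xi)-\nabla f(x)\|^2]\le\sigma^2$ for every $x\in\mathbb{R}^d$, and that $\|\nabla f(x)\|\le G$ for every $x\in\mathbb{R}^d$. Let $\beta\in[0,1)$, $s\ge 0$, $C>0$, let $t\ge 0$ be an integer, and run the stochastic unified momentum (SUM) method from $x_0\in\mathbb{R}^d$ for $t$ iterations with stochastic gradients $\mathcal G(x_k;\xi_k)$ and step size $\alpha=\min\left\{\frac{1-\beta}{2L[1+((1-\beta)s-1)^2]},\frac{C}{\sqrt{t+1}}\right\}$. Then $$\min_{k=0,\ldots,t}\mathbb{E}[\|\nabla f(x_k)\|^2]\le \frac{2(f(x_0)-f_* )(1-\beta)}{t+1}\,\Lambda+\frac{C}{\sqrt{t+1}}\cdot\frac{L\beta^2(G^2+\sigma^2)+L\sigma^2(1-\beta)^2}{(1-\beta)^3},$$ where $\Lambda=\max\left\{\frac{2L[1+((1-\beta)s-1)^2]}{1-\beta},\frac{\sqrt{t+1}}{C}\right\}$.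
   Context: $\|\cdot\|$ is the Euclidean norm. A differentiable function $f$ is $L$-smooth if $\|\nabla f(y)-\nabla f(x)\|\le L\|y-x\|$ for all $x,y\in\mathbb{R}^d$. $\mathcal G(x;\xi)\in\mathbb{R}^d$ is a stochastic gradient of $f$ at $x$ depending on a random variable $\xi$. The random variables $\xi_0,\xi_1,\dots$ are independent copies of $\xi$, so that $x_k$ depends only on $\xi_0,\dots,\xi_{k-1}$ and the moment conditions on $\mathcal G$ hold conditionally at $x_k$. The starting point $x_0$ is deterministic. The SUM method with parameters $\alpha>0$, $\beta\in[0,1)$, $s\ge0$ and starting point $x_0$ is: set $y^s_0=x_0$ and for $k\ge 0$ $$y_{k+1}=x_k-\alpha\,\mathcal G(x_k;\xi_k),\qquad y^s_{k+1}=x_k-s\alpha\,\mathcal G(x_k;\xi_k),\qquad x_{k+1}=y_{k+1}+\beta\,(y^s_{k+1}-y^s_k).$$ *)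

(* Defs.v *)
From HB Require Import structures.
From mathcomp Require Import all_boot all_order all_algebra finmap.
From mathcomp Require Import all_classical all_reals all_analysis.

Set Implicit Arguments.
Unset Strict Implicit.
Unset Printing Implicit Defensive.

Import Order.TTheory GRing.Theory Num.Theory.
Import numFieldNormedType.Exports.

Local Open Scope classical_set_scope.
Local Open Scope ring_scope.

(* The library norm [`|x|] on ['rV[R]_d] is the sup norm, hence a separate
   definition of the Euclidean one.  Both induce the same topology and the same
   notion of differentiability. *)
Definition norm2 (R : realType) (d : nat) (x : 'rV[R]_d) : R :=
  Num.sqrt (\sum_(i < d) x 0 i ^+ 2).

Definition grad (R : realType) (d : nat) (f : 'rV[R]_d -> R) (x : 'rV[R]_d) :
    'rV[R]_d :=
  \row_(i < d) 'D_(delta_mx 0 i) f x.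

Definition smooth (R : realType) (d : nat) (L : R) (f : 'rV[R]_d -> R) : Prop :=
  (forall x, differentiable f x) /\
  (forall x y, norm2 (grad f y - grad f x) <= L * norm2 (y - x)).

(* ['rV[R]_d] with its Borel sigma-algebra. *)
Definition borel_rV (R : realType) (d : nat) :=
  g_sigma_algebraType (@open 'rV[R]_d).

Definition mutually_independent (dO dX : measure_display)
    (Omega : measurableType dO) (Xi : measurableType dX) (R : realType)
    (P : probability Omega R) (X : nat -> {RV P >-> Xi}) : Prop :=
  forall (J : {fset nat}) (A : nat -> set Xi),
    (forall k, measurable (A k)) ->
    P (\bigcap_(k in [set` J]) (X k @^-1` A k)) =
    (\prod_(k <- J) P (X k @^-1` A k))%E.

Definition independent_copies (dO dX : measure_display)
    (Omega : measurableType dO) (Xi : measurableType dX) (R : realType)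
    (P : probability Omega R) (X0 : {RV P >-> Xi}) (X : nat -> {RV P >-> Xi}) :
    Prop :=
  mutually_independent X /\
  (forall k (A : set Xi), measurable A ->
     distribution P (X k) A = distribution P X0 A).

(* [sum_state alpha beta s g x0 z k] is the pair [(x_k, y^s_k)] of the SUM
   method run with the stochastic gradient [g] on the noise sequence [z]. *)
Fixpoint sum_state (R : realType) (d : nat) (Xi : Type) (alpha beta s : R)
    (g : 'rV[R]_d -> Xi -> 'rV[R]_d) (x0 : 'rV[R]_d) (z : nat -> Xi) (k : nat) :
    'rV[R]_d * 'rV[R]_d :=
  if k is j.+1 then
    let: (x, ys) := sum_state alpha beta s g x0 z j in
    let y' := x - alpha *: g x (z j) in
    let ys' := x - (s * alpha) *: g x (z j) in
    (y' + beta *: (ys' - ys), ys')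
  else (x0, x0).

Definition sum_iterate (R : realType) (d : nat) (Xi : Type) (alpha beta s : R)
    (g : 'rV[R]_d -> Xi -> 'rV[R]_d) (x0 : 'rV[R]_d) (z : nat -> Xi) (k : nat) :
    'rV[R]_d :=
  (sum_state alpha beta s g x0 z k).1.

(* Main.v *)
(** Writing v_k = x_k - y^s_k, a = alpha / (1 - beta) and q = (1 - beta) s - 1, the
    method satisfies v_{k+1} = beta v_k + q alpha G_k, and the auxiliary point
    z_k = x_k + beta / (1 - beta) v_k moves by plain stochastic gradient steps,
    z_{k+1} = z_k - a G_k.  The descent inequality of f at z_k, in expectation
    over the fresh noise xi_k, produces - a <grad f(z_k), grad f(x_k)>.  By
    smoothness |grad f(z_k) - grad f(x_k)| <= L a beta |q| |u_k| with
    u_{k+1} = beta u_k + G_k, and weighting Young's inequality so that q^2 falls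
    on |grad f(x_k)|^2 lets the step size absorb it; E|u_k|^2 is at most
    (G^2 + sigma^2) / (1 - beta)^2.  Telescoping E f(z_k) bounds the average of
    E|grad f(x_k)|^2.  Averaging over xi_k alone is Fubini's theorem: the law of
    (state_k, xi_k) is a product measure, by induction on k, keeping the state
    independent of every event on finitely many later noises. *)
Require Import Defs.
From HB Require Import structures.
From mathcomp Require Import all_boot all_order all_algebra finmap.
From mathcomp Require Import all_classical all_reals all_analysis.
From mathcomp Require Import measurable_realfun.
From mathcomp Require Import ring lra.

Set Implicit Arguments.
Unset Strict Implicit.
Unset Printing Implicit Defensive.

Import Order.TTheory GRing.Theory Num.Theory.
Import numFieldNormedType.Exports.

Local Open Scope classical_set_scope.
Local Open Scope ring_scope.

(** * Euclidean inner product and norm *)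

Section euclidean.
Context {R : realType} {d : nat}.
Implicit Types (x y v : 'rV[R]_d).

Definition dotv x y : R := \sum_(i < d) x 0 i * y 0 i.

Lemma dotvC x y : dotv x y = dotv y x.
Proof. by apply: eq_bigr => i _; rewrite mulrC. Qed.

Lemma dotvDl x y v : dotv (x + y) v = dotv x v + dotv y v.
Proof. by rewrite /dotv -big_split; apply: eq_bigr => i _; rewrite mxE mulrDl. Qed.

Lemma dotvZl a x y : dotv (a *: x) y = a * dotv x y.
Proof. by rewrite /dotv mulr_sumr; apply: eq_bigr => i _; rewrite mxE mulrA. Qed.

Lemma dotvDr x y v : dotv v (x + y) = dotv v x + dotv v y.
Proof. by rewrite !(dotvC v) dotvDl. Qed.

Lemma dotvZr a x y : dotv x (a *: y) = a * dotv x y.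
Proof. by rewrite dotvC dotvZl dotvC. Qed.

Lemma dotvv_ge0 x : 0 <= dotv x x.
Proof. by apply: sumr_ge0 => i _; rewrite -expr2 sqr_ge0. Qed.

Lemma norm2_ge0 x : 0 <= norm2 x.
Proof. exact: sqrtr_ge0. Qed.

Lemma norm2E x : norm2 x = Num.sqrt (dotv x x).
Proof. by rewrite /norm2; congr Num.sqrt; apply: eq_bigr => i _; rewrite expr2. Qed.

Lemma norm2_sqr x : norm2 x ^+ 2 = dotv x x.
Proof. by rewrite norm2E sqr_sqrtr// dotvv_ge0. Qed.

Lemma norm2Z a x : norm2 (a *: x) = `|a| * norm2 x.
Proof.
by rewrite !norm2E dotvZl dotvZr mulrA -expr2 sqrtrM ?sqr_ge0// sqrtr_sqr.
Qed.

Lemma norm2_eq0 x : norm2 x = 0 -> x = 0.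
Proof.
move=> x0; have /psumr_eq0P xi0 : dotv x x = 0 by rewrite -norm2_sqr x0 expr0n.
apply/rowP => i; rewrite mxE; apply/eqP.
by rewrite -sqrf_eq0 expr2 xi0// => j _; rewrite -expr2 sqr_ge0.
Qed.

(** Cauchy-Schwarz: for nonzero vectors the squared norm of [norm2 y *: x - norm2 x *: y] is twice
    [norm2 x * norm2 y] times the gap between the two sides. *)
Lemma dotv_le_norm2 x y : dotv x y <= norm2 x * norm2 y.
Proof.
have [/norm2_eq0 ->|x0] := eqVneq (norm2 x) 0.
  by rewrite /dotv big1 ?mulr_ge0 ?norm2_ge0// => i _; rewrite mxE mul0r.
have [/norm2_eq0 ->|y0] := eqVneq (norm2 y) 0.
  by rewrite /dotv big1 ?mulr_ge0 ?norm2_ge0// => i _; rewrite mxE mulr0.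
have xp : 0 < norm2 x by rewrite lt_neqAle eq_sym x0 norm2_ge0.
have yp : 0 < norm2 y by rewrite lt_neqAle eq_sym y0 norm2_ge0.
have := dotvv_ge0 (norm2 y *: x + (- norm2 x) *: y).
rewrite !(dotvDl, dotvDr, dotvZl, dotvZr) (dotvC y x) -!norm2_sqr => H.
have : 0 <= (norm2 x * norm2 y) * (norm2 x * norm2 y - dotv x y) by lra.
by rewrite pmulr_rge0 ?subr_ge0// mulr_gt0.
Qed.

End euclidean.

(** * Derivatives along lines and the descent inequality *)

Section smooth_functions.
Context {R : realType} {d : nat}.
Implicit Types (f : 'rV[R]_d -> R) (x y v : 'rV[R]_d).

Lemma derive_gradE f x v : differentiable f x -> 'D_v f x = dotv (grad f x) v.
Proof.
move=> df; rewrite deriveE// {1}[v]row_sum_delta linear_sum.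
by apply: eq_bigr => i _; rewrite linearZ /grad mxE deriveE// mulrC.
Qed.

Lemma is_derive_line f x v (t : R) : differentiable f (x + t *: v) ->
  is_derive t (1 : R) (fun r : R => f (x + r *: v)) (dotv (grad f (x + t *: v)) v).
Proof.
move=> /[dup] df /diff_derivable dfv.
have lineE : (fun h : R => h^-1 *: (f (x + (h *: (1 : R) + t) *: v)
                                    - f (x + t *: v)))
    = (fun h : R => h^-1 *: (f (h *: v + (x + t *: v)) - f (x + t *: v))).
  apply/funext => h; congr (_ *: (f _ - _)).
  by rewrite [h *: (1 : R)]mulr1 scalerDl addrCA.
apply: DeriveDef; first by rewrite /derivable lineE; exact: dfv.
by rewrite -derive_gradE// /derive lineE.
Qed.

(** Up to the constant [f x], the function [h] is [f] minus its quadratic model along the segment.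
    Cauchy-Schwarz and the Lipschitz gradient make its derivative nonpositive for positive [r]. *)
Lemma smooth_le_quadratic (L : R) f x v : smooth L f ->
  f (x + v) <= f x + dotv (grad f x) v + L / 2 * norm2 v ^+ 2.
Proof.
move=> [df gL].
pose h (r : R) := f (x + r *: v) - r * dotv (grad f x) v
                  - L / 2 * norm2 v ^+ 2 * r ^+ 2.
have dh (r : R) : is_derive r (1 : R) h
    (dotv (grad f (x + r *: v)) v - dotv (grad f x) v - L * norm2 v ^+ 2 * r).
  have dl := is_derive_line (df (x + r *: v)).
  have := is_deriveB (is_deriveB dl (is_deriveM (is_derive_id r (1 : R))
    (is_derive_cst (dotv (grad f x) v) r (1 : R))))
    (is_deriveM (is_derive_cst (L / 2 * norm2 v ^+ 2) r (1 : R))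
      (is_deriveX 2 (is_derive_id r (1 : R)))).
  move=> H; apply: (is_derive_eq H).
  rewrite !scaler0 add0r addr0 /cst /= expr1 ![_%:A]mulr1.
  congr (_ - _); transitivity (L / 2 * norm2 v ^+ 2 * (2 * r)) => //.
  by field.
have : h 1 <= h 0.
  apply: (@ler0_derive1_le_cc _ h 0 1); rewrite ?bound_itvE//.
  - move=> r; rewrite in_itv/= => /andP[r0 _].
    rewrite derive1E (@derive_val _ _ _ _ _ _ _ (dh r)).
    have := dotv_le_norm2 (grad f (x + r *: v) - grad f x) v.
    have := gL x (x + r *: v).
    rewrite (addrC x) addrK norm2Z gtr0_norm// dotvDl -scaleN1r dotvZl => H1 H2.
    have := ler_wpM2r (norm2_ge0 v) H1; lra.
  - by apply: derivable_within_continuous => r _; case: (dh r).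
by rewrite /h scale1r scale0r addr0; lra.
Qed.

End smooth_functions.

(** * Borel measurability of vector-valued maps *)

Section borel_rV.
Context {R : realType} {n : nat}.

(* Open sets are countable unions of sup-norm balls with rational centers and
   radii [1 / (k + 1)]. *)
Lemma measurable_fun_borel_rV dT (T : measurableType dT) (h : T -> borel_rV R n) :
  (forall i, measurable_fun setT (fun t => (h t : 'rV[R]_n) 0 i)) ->
  measurable_fun setT h.
Proof.
move=> mh; apply: (@measurability _ _ T (borel_rV R n) setT h (@open 'rV[R]_n)) => // _ [U oU <-].
rewrite setTI.
pose B (p : 'rV[rat]_n * nat) : set 'rV[R]_n :=
  [set y | forall i, ball (ratr (p.1 0 i) : R) p.2.+1%:R^-1 (y 0 i)].
have UE : U = \bigcup_(p in [set p | B p `<=` U]) B p.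
  apply/seteqP; split => [x Ux|x [p /= BU /BU//]].
  have [e e0 xeU] : nbhs_ball x U by apply/nbhs_ballP; exact: open_nbhs_nbhs.
  (* With radius below [e / 2], a ball around a rational center that contains [x] stays inside the
     [e]-ball of [x] by the triangle inequality. *)
  have [k] := @ltr_add_invr R 0 (e / 2) (divr_gt0 e0 (ltr0Sn _ _)); rewrite add0r => ke.
  have /choice[q hq] (i : 'I_n) : exists q : rat, ball (x 0 i) k.+1%:R^-1 (ratr q).
    have /rat_in_itvoo[q qx] : x 0 i - k.+1%:R^-1 < x 0 i + k.+1%:R^-1.
      by rewrite ltrD2l gtrN// invr_gt0.
    exists q; rewrite /ball/= ltr_distlC.
    by move/itvP: qx => qx; rewrite !qx.
  exists (\row_i q i, k) => /=; last first.
    by move=> i /=; rewrite mxE; apply: ball_sym; exact: hq.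
  move=> y By; apply: xeU; split => // i j; rewrite (ord1 i).
  have xq : ball (x 0 j) (e / 2) (ratr (q j) : R).
    by apply: le_ball (hq j); exact: ltW.
  have qy : ball (ratr (q j) : R) (e / 2) (y 0 j).
    by have := By j; rewrite /= mxE; apply: le_ball; exact: ltW.
  by rewrite [e]splitr; exact: ball_triangle xq qy.
rewrite UE preimage_bigcup bigcup_mkcond.
apply: countable_bigcupT_measurable; first exact: countableP.
move=> p; case: ifPn => // _.
have -> : h @^-1` B p = \bigcap_(i : 'I_n)
    ((fun t => (h t : 'rV[R]_n) 0 i) @^-1` ball (ratr (p.1 0 i) : R) p.2.+1%:R^-1).
  by apply/seteqP; split => [t Bt i _|t Bt i]; [exact: Bt|exact: (Bt i)].
apply: fin_bigcap_measurable => // i _; rewrite -[X in measurable X]setTI.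
by apply: mh => //; exact: measurable_ball.
Qed.

Lemma continuous_measurable_borel_rV (h : 'rV[R]_n -> R) : continuous h ->
  measurable_fun setT (h : borel_rV R n -> R).
Proof.
move=> /continuousP ch; apply: (measurability _ (RGenOpens.measurableE R)).
move=> _ [_ [a [b ->] <-]]; rewrite setTI; apply: sub_sigma_algebra.
exact/ch/interval_open.
Qed.

Lemma measurable_coord (i : 'I_n) :
  measurable_fun setT (fun x : borel_rV R n => (x : 'rV[R]_n) 0 i).
Proof. exact: (continuous_measurable_borel_rV (@coord_continuous _ _ _ _ i)). Qed.

Context dT (T : measurableType dT).
Implicit Types h g : T -> borel_rV R n.

Lemma measurable_funD_rV h g : measurable_fun setT h -> measurable_fun setT g ->
  measurable_fun setT (fun t => (h t : 'rV[R]_n) + (g t : 'rV[R]_n) : borel_rV R n).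
Proof.
move=> mh mg; apply: measurable_fun_borel_rV => i; under eq_fun do rewrite mxE.
by apply: measurable_funD; exact: (measurableT_comp (measurable_coord i)).
Qed.

Lemma measurable_funZ_rV (a : R) h : measurable_fun setT h ->
  measurable_fun setT (fun t => a *: (h t : 'rV[R]_n) : borel_rV R n).
Proof.
move=> mh; apply: measurable_fun_borel_rV => i; under eq_fun do rewrite mxE.
apply: measurable_funM; first exact: measurable_cst.
exact: (measurableT_comp (measurable_coord i)).
Qed.

Lemma measurable_dotv h g : measurable_fun setT h -> measurable_fun setT g ->
  measurable_fun setT (fun t => dotv (h t) (g t)).
Proof.
move=> mh mg; apply: measurable_sum => i.
by apply: measurable_funM; exact: (measurableT_comp (measurable_coord i)).
Qed.

End borel_rV.

(** Rectangles are stable under intersection and generate the product sigma-algebra; the whole space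
    is itself a rectangle of finite measure, so a constant exhausting sequence suffices. *)
Lemma finite_measure_eq_rectangles d1 d2 (T1 : measurableType d1)
    (T2 : measurableType d2) (R : realType)
    (m1 m2 : {measure set (T1 * T2) -> \bar R}) :
  (m1 setT < +oo)%E ->
  (forall A B, measurable A -> measurable B -> m1 (A `*` B) = m2 (A `*` B)) ->
  forall X, measurable X -> m1 X = m2 X.
Proof.
move=> m1oo m12 X mX.
apply: (measure_unique [set A `*` B | A in measurable & B in measurable]
  (fun=> setT)) => //.
- exact: measurable_prod_measurableType.
- move=> _ _ [A1 mA1 [B1 mB1 <-]] [A2 mA2 [B2 mB2 <-]].
  rewrite -setXI; exists (A1 `&` A2); first exact: measurableI.
  by exists (B1 `&` B2) => //; exact: measurableI.
- by move=> _; exists setT => //; exists setT => //; rewrite setXTT.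
- by rewrite bigcup_const.
- by move=> _ [A mA [B mB <-]]; exact: m12.
Qed.

(** * Independence of the state from later noise, and averaging over the fresh noise *)

Section independent_noise.
Context {dO dX dT : measure_display} {Omega : measurableType dO}
  {Xi : measurableType dX} {T : measurableType dT} {R : realType}.
Variables (P : probability Omega R) (xi : {RV P >-> Xi})
  (xis : nat -> {RV P >-> Xi}) (s0 : T) (Phi : T * Xi -> T)
  (S : nat -> {RV P >-> T}).
Hypothesis xisP : independent_copies xi xis.
Hypothesis mPhi : measurable_fun setT Phi.
Hypothesis S0 : forall w, S 0 w = s0.
Hypothesis SS : forall k w, S k.+1 w = Phi (S k w, xis k w).

Let future (J : {fset nat}) (A : nat -> set Xi) : set Omega :=
  \bigcap_(j in [set` J]) (xis j @^-1` A j).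

Let measurable_future J A : (forall j, measurable (A j)) ->
  measurable (future J A).
Proof.
move=> mA; apply: fin_bigcap_measurable; first exact: finite_fset.
by move=> j _; exact: measurable_funPTI.
Qed.

(** Allowing any finite set of later noises makes the induction close: the noise [xis k] consumed by
    the next step is itself one of the later noises at time [k]. *)
Lemma markov_chain_indep_future k (J : {fset nat}) (A : nat -> set Xi) (E : set T) :
  (forall j, measurable (A j)) -> measurable E -> (forall j, j \in J -> (k <= j)%N) ->
  (P (S k @^-1` E `&` future J A) = P (S k @^-1` E) * P (future J A))%E.
Proof.
move=> mA mE; elim: k E mE J A mA => [|k IH] E mE J A mA kJ.
  (* The initial state is deterministic, so its event is either everything or empty. *)
  have [Es0|Es0] := pselect (E s0).
    have -> : S 0 @^-1` E = setT by apply/seteqP; split => w //= _; rewrite S0.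
    by rewrite setTI probability_setT mul1e.
  have -> : S 0 @^-1` E = set0 by apply/seteqP; split => w //=; rewrite S0.
  by rewrite set0I measure0 mul0e.
have mQ := measurable_future J mA; set Q := future J A in mQ *.
pose Z : {mfun Omega >-> (T * Xi)%type} := HB.pack (fun w => (S k w, xis k w))
  (isMeasurableFun.Build _ _ _ _ (fun w => (S k w, xis k w))
    (measurable_fun_pair (measurable_funPT (S k)) (measurable_funPT (xis k)))).
have PQ : P Q \is a fin_num by exact: fin_num_measure.
pose c : {nonneg R} := NngNum (fine_ge0 (measure_ge0 P Q)).
have -> : S k.+1 @^-1` E = Z @^-1` (Phi @^-1` E).
  by apply/seteqP; split => w /=; rewrite SS.
have cE : c%:num%:E = P Q by rewrite /= fineK.
rewrite muleC -cE.
(* Both sides are values of finite measures on state-noise pairs: [P] restricted to [Q] and pushed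
   forward by [Z], against [P Q] times the law of [Z]. *)
apply: (@finite_measure_eq_rectangles _ _ _ _ _
  (pushforward (mrestr P mQ) Z) (mscale c (pushforward P Z))).
- apply: (@le_lt_trans _ _ (P setT)); last by rewrite probability_setT ltry.
  by apply: le_measure; rewrite ?inE// preimage_setT setTI.
- move=> E' B mE' mB; transitivity (P (Z @^-1` (E' `*` B) `&` Q)) => //.
  transitivity (P Q * P (Z @^-1` (E' `*` B)))%E; last by rewrite -cE.
  have ZE C : Z @^-1` (E' `*` B) `&` C = S k @^-1` E' `&` (xis k @^-1` B `&` C).
    by apply/seteqP; split => [w [[? ?] ?]|w [? [? ?]]].
  (* The constraint [B] on [xis k] is absorbed into a future event. Since [k] lies outside [J], the
     event on [J] is unchanged, and the induction hypothesis applies both to [J] enlarged by [k] and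
     to [k] alone. *)
  pose A' j := if j == k then B else A j.
  have mA' j : measurable (A' j) by rewrite /A'; case: ifP.
  have kNJ : k \notin J by apply/negP => /kJ; rewrite ltnn.
  have Q' : future J A' = Q.
    apply: eq_bigcapr => j /= jJ; rewrite /A'; case: eqP => // jk.
    by rewrite -jk jJ in kNJ.
  have kQ' : future (k |` J)%fset A' = xis k @^-1` B `&` Q.
    rewrite /future set_fsetU1 bigcap_setU1 /A' eqxx; congr (_ `&` _).
    exact: Q'.
  have k' : future [fset k]%fset A' = xis k @^-1` B.
    by rewrite /future set_fset1 bigcap_set1 /A' eqxx.
  rewrite ZE -kQ' IH//; last first.
    by move=> j; rewrite in_fset1U => /orP[/eqP ->//|/kJ/ltnW].
  rewrite -[Z @^-1` _]setIT ZE setIT -k' IH//; last first.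
    by move=> j; rewrite in_fset1 => /eqP ->.
  rewrite -Q' muleCA; congr (_ * _)%E; rewrite /future.
  rewrite !xisP.1// big_fsetU1//= big_seq_fset1 muleC.
  by [].
- by rewrite -[X in measurable X]setTI; exact: mPhi.
Qed.

(** Independence makes the law of the pair a product, Tonelli integrates the noise first, and
    [xis k] has the law of [xi]. *)
Lemma ge0_integral_markov_step k (h : T * Xi -> \bar R) :
  measurable_fun setT h -> (forall z, 0 <= h z)%E ->
  (\int[P]_w h (S k w, xis k w) = \int[P]_w \int[P]_v h (S k w, xi v))%E.
Proof.
move=> mh h0.
pose Z : {mfun Omega >-> (T * Xi)%type} := HB.pack (fun w => (S k w, xis k w))
  (isMeasurableFun.Build _ _ _ _ (fun w => (S k w, xis k w))
    (measurable_fun_pair (measurable_funPT (S k)) (measurable_funPT (xis k)))).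
have ZE X : measurable X ->
    (distribution P (S k) \x distribution P (xis k))%E X = distribution P Z X.
  apply: product_measure_unique => E B mE mB /=.
  pose A (j : nat) := B.
  have k' : future [fset k]%fset A = xis k @^-1` B.
    by rewrite /future set_fset1 bigcap_set1.
  transitivity (P (S k @^-1` E `&` future [fset k]%fset A)).
    by rewrite k' /distribution /pushforward; congr (P _).
  rewrite markov_chain_indep_future//; last first.
    by move=> j; rewrite in_fset1 => /eqP ->.
  by rewrite k'.
transitivity (\int[distribution P Z]_z h z)%E.
  by rewrite ge0_integral_distribution.
transitivity (\int[distribution P (S k) \x distribution P (xis k)]_z h z)%E.
  by apply: eq_measure_integral => X mX _; exact/esym/ZE.
rewrite fubini_tonelli1// ge0_integral_distribution//; last 2 first.
- exact: measurable_fun_fubini_tonelli_F.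
- by move=> y; exact: integral_ge0.
apply: eq_integral => w _; rewrite /= /fubini_F.
transitivity (\int[distribution P xi]_y h (S k w, y))%E.
  by apply: eq_measure_integral => X mX _; exact: xisP.2.
rewrite ge0_integral_distribution//.
by apply: measurableT_comp => //; exact: pair1_measurable.
Qed.

Lemma le_integral_markov_step k (h : T * Xi -> R) (K : T -> R) :
  measurable_fun setT h -> measurable_fun setT K -> (forall z, 0 <= h z) ->
  (forall s, \int[P]_v (h (s, xi v))%:E <= (K s)%:E)%E ->
  (\int[P]_w (h (S k w, xis k w))%:E <= \int[P]_w (K (S k w))%:E)%E.
Proof.
move=> mh mK h0 hK.
rewrite (@ge0_integral_markov_step k (EFin \o h))//; last first.
  exact/measurable_EFinP.
have ih0 s : (0 <= \int[P]_v (h (s, xi v))%:E)%E.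
  by apply: integral_ge0 => v _; rewrite lee_fin.
apply: ge0_le_integral => //=.
- have mh' : measurable_fun setT (EFin \o h) by exact/measurable_EFinP.
  have h0' z : (0 <= (EFin \o h) z)%E by rewrite /= lee_fin.
  (* Measurability of the inner integral in the state comes from Tonelli, once it is read as an
     integral against the law of [xi]. *)
  have mF := measurable_fun_fubini_tonelli_F (m2 := distribution P xi) (EFin \o h) mh' h0'.
  apply: (eq_measurable_fun (fubini_F (distribution P xi) (EFin \o h) \o S k)).
    move=> w _; rewrite /= /fubini_F ge0_integral_distribution//.
    by apply: measurableT_comp => //; exact: pair1_measurable.
  exact: measurableT_comp.
- by apply/measurable_EFinP; exact: measurableT_comp.
Qed.

End independent_noise.

(** * Expectation of a quadratic function of centred noise *)

Section quadratic_noise.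
Context {dO : measure_display} {Omega : measurableType dO} {R : realType} {d : nat}.
Variables (P : probability Omega R) (Y : Omega -> 'rV[R]_d) (m : 'rV[R]_d).
Variables (sigma : R).
Hypothesis mY : forall i, measurable_fun setT (fun w => Y w 0 i).
Hypothesis EY : forall i, ('E_P[fun w => (Y w 0 i)%R] = (m 0 i)%:E)%E.
Hypothesis VY : ('E_P[fun w => (norm2 (Y w - m) ^+ 2)%R] <= (sigma ^+ 2)%:E)%E.

Let N w := norm2 (Y w - m) ^+ 2.

Let mD i : measurable_fun setT (fun w => (Y w - m) 0 i).
Proof.
under eq_fun do rewrite 2!mxE.
by apply: measurable_funD => //; exact: measurable_cst.
Qed.

Let mN : measurable_fun setT N.
Proof.
rewrite /N; under eq_fun do rewrite norm2_sqr.
by apply: measurable_sum => i; exact: measurable_funM.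
Qed.

Let N_int : P.-integrable setT (EFin \o N).
Proof.
apply/integrableP; split; first exact/measurable_EFinP.
under eq_integral do rewrite /= ger0_norm ?sqr_ge0//.
by move: VY; rewrite unlock => /le_lt_trans; apply; rewrite ltry.
Qed.

(** The second moment controls the first: [|t| <= 1 + t ^+ 2], the square is at most [N], and
    constants are integrable under [P]. *)
Let D_int i : P.-integrable setT (fun w => ((Y w - m) 0 i)%:E).
Proof.
apply: (@le_integrable _ _ _ P setT measurableT _ (EFin \o (cst 1 \+ N))).
- exact/measurable_EFinP.
- move=> w _ /=; rewrite lee_fin [leRHS]ger0_norm ?addr_ge0 ?sqr_ge0//.
  rewrite /N norm2_sqr; set v := Y w - m.
  have : v 0 i ^+ 2 <= dotv v v.
    rewrite /dotv (bigD1 i)//= -expr2 lerDl sumr_ge0// => j _.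
    by rewrite -expr2 sqr_ge0.
  rewrite -[v 0 i ^+ 2]real_normK ?num_real// => H.
  have := sqr_ge0 (`|v 0 i| - 1); have := normr_ge0 (v 0 i); nra.
- rewrite (_ : EFin \o _ = (cst 1%:E \+ (EFin \o N))%E)//.
  apply: integrableD => //.
  exact: finite_measure_integrable_cst.
Qed.

Let int_D i : (\int[P]_w ((Y w - m) 0 i)%:E = 0)%E.
Proof.
have Yi : P.-integrable setT (EFin \o (fun w => Y w 0 i)).
  rewrite (_ : _ \o _ = ((fun w => ((Y w - m) 0 i)%:E) \+ cst (m 0 i)%:E)%E).
    by apply: integrableD => //; exact: finite_measure_integrable_cst.
  by apply/funext => w /=; rewrite !mxE -EFinD subrK.
under eq_integral do rewrite 2!mxE EFinB.
rewrite integralB//; last exact: finite_measure_integrable_cst.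
have := EY i; rewrite unlock => ->.
by rewrite integral_cst// [X in (_ * X)%E]probability_setT mule1 subee.
Qed.

(** The noise is centred, so the linear term integrates to zero and only the variance term
    survives. *)
Lemma ge0_integral_le_quadratic (h : Omega -> R) (A C : R) (b : 'rV[R]_d) :
  measurable_fun setT h -> (forall w, 0 <= h w) -> 0 <= C ->
  (forall w, h w <= A + dotv b (Y w - m) + C * norm2 (Y w - m) ^+ 2) ->
  (\int[P]_w (h w)%:E <= (A + C * sigma ^+ 2)%:E)%E.
Proof.
move=> mh h0 C0 hle.
have b_int : P.-integrable setT (fun w => \sum_(i < d) (b 0 i)%:E * ((Y w - m) 0 i)%:E)%E.
  by apply: integrable_sum => // i _; exact: integrableZl.
have A_int : P.-integrable setT (cst A%:E : Omega -> \bar R).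
  exact: finite_measure_integrable_cst.
have C_int : P.-integrable setT (fun w => C%:E * (N w)%:E)%E.
  exact: integrableZl.
pose I w := (A%:E + \sum_(i < d) (b 0 i)%:E * ((Y w - m) 0 i)%:E
  + C%:E * (N w)%:E)%E.
have hI w : ((h w)%:E <= I w)%E.
  rewrite /I -EFinM; under eq_bigr do rewrite -EFinM.
  by rewrite sumEFin -!EFinD lee_fin; exact: hle.
have I_int : P.-integrable setT I.
  by apply: integrableD => //; exact: integrableD.
apply: (@le_trans _ _ (\int[P]_w I w)%E).
  apply: ge0_le_integral => //.
  - by move=> w _; rewrite lee_fin.
  - exact/measurable_EFinP.
  - exact: measurable_int I_int.
rewrite /I integralD//; last exact: integrableD.
rewrite integralD// integral_cst// [X in (_ * X)%E]probability_setT mule1 integral_sum//; last first.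
  by move=> i; exact: integrableZl.
rewrite big1 => [|i _]; last by rewrite integralZl// int_D mule0.
rewrite adde0 integralZl// EFinD EFinM leeD2l// lee_wpmul2l ?lee_fin//.
by move: VY; rewrite unlock.
Qed.

End quadratic_noise.

(** * Continuity of the gradient, for measurability *)

Section smooth_continuity.
Context {R : realType} {d : nat}.
Implicit Types f : 'rV[R]_d -> R.

Lemma norm2_coord (x : 'rV[R]_d) (i : 'I_d) : `|x 0 i| <= norm2 x.
Proof.
rewrite -sqrtr_sqr norm2E ler_wsqrtr// /dotv (bigD1 i)//= -expr2 lerDl.
by apply: sumr_ge0 => j _; rewrite -expr2 sqr_ge0.
Qed.

Lemma continuous_norm2B (x : 'rV[R]_d) : continuous (fun y : 'rV[R]_d => norm2 (y - x)).
Proof.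
move=> y; rewrite /norm2.
apply: (@continuous_comp _ _ _
  (fun y : 'rV[R]_d => \sum_(i < d) (y - x) 0 i ^+ 2) (@Num.sqrt R)).
  apply: continuous_big => [|i _ {}y]; first exact: add_continuous.
  under eq_fun do rewrite 2!mxE.
  apply: (@continuous_comp _ _ _ (fun y : 'rV[R]_d => y 0 i - x 0 i)
    (fun r : R => r ^+ 2)); last exact: exprn_continuous.
  by apply: continuousB; [exact: coord_continuous|exact: cst_continuous].
exact: sqrt_continuous.
Qed.

(** The Lipschitz bound is Euclidean while the topology comes from the sup norm; the bridge is that
    [L * norm2 (y - x)] is continuous in [y] and vanishes at [x]. *)
Lemma continuous_grad (L : R) f (i : 'I_d) : smooth L f ->
  continuous (fun x => grad f x 0 i).
Proof.
move=> [_ gL] x; apply/(@cvgrPdist_le _ _ _ _ (nbhs_filter x)) => e e0.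
have : {for x, continuous (fun y : 'rV[R]_d => L * norm2 (y - x))}.
  apply: continuousM; [apply: cst_continuous|apply: continuous_norm2B].
rewrite /prop_for/continuous_at subrr [X in _ --> L * X]norm2E /dotv big1 ?sqrtr0 ?mulr0; last first.
  by move=> j _; rewrite mxE mul0r.
move=> /(@cvgrPdist_le _ _ _ _ (nbhs_filter x))/(_ e e0); apply: filterS => y.
rewrite sub0r normrN; apply: le_trans; apply: (le_trans _ (ler_norm _)).
rewrite distrC; apply: le_trans (gL x y).
have -> : grad f y 0 i - grad f x 0 i = (grad f y - grad f x) 0 i.
  by rewrite !mxE.
exact: norm2_coord.
Qed.

End smooth_continuity.

(* The SUM iterates in the variables [z = x + beta / (1 - beta) (x - y^s)], which
   performs plain gradient steps of size [a = alpha / (1 - beta)], and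
   [u = (x - y^s) / (q alpha)], where [q = (1 - beta) s - 1], a geometric average
   of the past stochastic gradients that makes sense also for [q = 0]. *)
Section auxiliary_chain.
Context {R : realType} {d : nat} {Xi : Type}.
Variables (g : 'rV[R]_d -> Xi -> 'rV[R]_d) (a beta q : R) (x0 : 'rV[R]_d).
Implicit Type p : 'rV[R]_d * 'rV[R]_d.

(** Recovers [x] from [(z, u)]: as [x - y^s = q alpha u] and [alpha = (1 - beta) a], the shift
    [beta / (1 - beta) (x - y^s)] equals [beta q a u]. *)
Definition chain_point p := p.1 - (beta * q * a) *: p.2.

Definition chain_step (r : ('rV[R]_d * 'rV[R]_d) * Xi) : 'rV[R]_d * 'rV[R]_d :=
  let G := g (chain_point r.1) r.2 in (r.1.1 - a *: G, beta *: r.1.2 + G).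

Fixpoint chain (xs : nat -> Xi) k :=
  if k is j.+1 then chain_step (chain xs j, xs j) else (x0, 0).

(** The coefficient of [u] in [y^s] is [beta q a + (1 - beta) q a = q a]; the recursions then agree
    coordinatewise. *)
Lemma sum_state_chain (s : R) xs k : q = (1 - beta) * s - 1 ->
  sum_state ((1 - beta) * a) beta s g x0 xs k =
  (chain_point (chain xs k), (chain xs k).1 - (q * a) *: (chain xs k).2).
Proof.
move=> qE; elim: k => [|k IH] /=.
  by rewrite /chain_point !scaler0 subr0.
rewrite IH; case: (chain xs k) => z u; rewrite /chain_step /chain_point/=.
set G := g _ _.
by congr pair; apply/rowP => i; rewrite !mxE qE; ring.
Qed.

End auxiliary_chain.

(** Nonnegativity takes the place of integrability, so expectations not yet known to be finite can
    be split. *)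
Lemma ge0_integral_affine d (T : measurableType d) (R : realType)
    (P : probability T R) (F : T -> R) (b c : R) :
  measurable_fun setT F -> (forall w, 0 <= F w) -> 0 <= b -> 0 <= c ->
  (\int[P]_w (b * F w + c)%:E = b%:E * \int[P]_w (F w)%:E + c%:E)%E.
Proof.
move=> mF F0 b0 c0; under eq_integral do rewrite EFinD EFinM.
have mF' : measurable_fun setT (fun w => (F w)%:E) by exact/measurable_EFinP.
rewrite ge0_integralD//; last first.
- by apply: measurable_funeM.
- by move=> w _; rewrite -EFinM lee_fin mulr_ge0.
rewrite integral_cst// [X in (_ + _ * X)%E]probability_setT mule1.
by rewrite ge0_integralZl// => w _; rewrite lee_fin.
Qed.

(** * Descent in expectation and telescoping *)

Section descent.
Context {dO dX : measure_display} {Omega : measurableType dO}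
  {Xi : measurableType dX} {R : realType} {d : nat}.
Variables (P : probability Omega R) (xi : {RV P >-> Xi})
  (xis : nat -> {RV P >-> Xi}) (f : 'rV[R]_d -> R)
  (g : 'rV[R]_d -> Xi -> 'rV[R]_d) (L sigma G a beta q : R) (x0 : 'rV[R]_d).
Hypothesis L_gt0 : 0 < L.
Hypothesis f_smooth : smooth L f.
Hypothesis f_lb : has_lbound (range f).
Hypothesis mg : measurable_fun [set: borel_rV R d * Xi]
  (fun z : borel_rV R d * Xi => g z.1 z.2 : borel_rV R d).
Hypothesis xisP : independent_copies xi xis.
Hypothesis g_mean : forall (x : 'rV[R]_d) (i : 'I_d),
  ('E_P[fun w => (g x (xi w) 0 i)%R] = (grad f x 0 i)%R%:E)%E.
Hypothesis g_var : forall x : 'rV[R]_d,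
  ('E_P[fun w => (norm2 (g x (xi w) - grad f x) ^+ 2)%R] <= (sigma ^+ 2)%R%:E)%E.
Hypothesis gradG : forall x : 'rV[R]_d, norm2 (grad f x) <= G.
Hypothesis beta_ge0 : 0 <= beta.
Hypothesis beta_lt1 : beta < 1.
Hypothesis a_gt0 : 0 < a.
Hypothesis a_small : L * a * (1 + q ^+ 2) <= 1.

Let V := borel_rV R d.
Let T : measurableType _ := (V * V)%type.
(** Shifting by the infimum makes the potential nonnegative, so its expectation always makes sense
    in the extended reals. *)
Let phi x := f x - inf (range f).
Let step : T * Xi -> T := chain_step g a beta q.
Let point : T -> V := chain_point a beta q.

Let phi_ge0 x : 0 <= phi x.
Proof. by rewrite subr_ge0; apply: (ge_inf f_lb); exists x. Qed.

Let mphi : measurable_fun setT (phi : V -> R).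
Proof.
apply: continuous_measurable_borel_rV => x.
apply: (@continuousB R R^o _ (f : 'rV[R]_d -> R^o) (cst (inf (range f)))); last exact: cst_continuous.
exact/differentiable_continuous/f_smooth.1.
Qed.

Let mgrad2 : measurable_fun setT (fun x : V => norm2 (grad f x) ^+ 2).
Proof.
under eq_fun do rewrite norm2_sqr.
apply: measurable_sum => i.
have mi := continuous_measurable_borel_rV (@continuous_grad _ _ _ _ i f_smooth).
exact: measurable_funM.
Qed.

Let mnorm2 : measurable_fun setT (fun x : V => norm2 (x : 'rV[R]_d) ^+ 2).
Proof. by under eq_fun do rewrite norm2_sqr; exact: measurable_dotv. Qed.

Let mpoint : measurable_fun setT point.
Proof.
rewrite /point /chain_point; under eq_fun do rewrite -scaleNr.
by apply: measurable_funD_rV => //; exact: measurable_funZ_rV.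
Qed.

Let mG : measurable_fun setT (fun r : T * Xi => g (point r.1) r.2 : V).
Proof.
apply: (measurableT_comp mg (g := fun r : T * Xi => (point r.1, r.2))).
by apply: measurable_fun_pair => //; exact: measurableT_comp.
Qed.

Let mstep : measurable_fun setT step.
Proof.
apply: measurable_fun_pair => /=.
- under eq_fun do rewrite -scaleNr.
  apply: measurable_funD_rV; last exact: measurable_funZ_rV.
  exact: (measurableT_comp measurable_fst measurable_fst).
- apply: measurable_funD_rV; last exact: mG.
  apply: measurable_funZ_rV.
  exact: (measurableT_comp measurable_snd measurable_fst).
Qed.

Let mS k : measurable_fun setT (fun w => chain g a beta q x0 (fun j => xis j w) k : T).
Proof.
elim: k => [|k IH] /=; first exact: measurable_cst.
apply: (measurableT_comp mstep (g := fun w =>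
  (chain g a beta q x0 (fun j => xis j w) k : T, xis k w))).
exact: measurable_fun_pair.
Qed.

Let S k : {RV P >-> T} := HB.pack (fun w => chain g a beta q x0 (fun j => xis j w) k : T)
  (isMeasurableFun.Build _ _ _ _ _ (mS k)).

Let mgxi x i : measurable_fun setT (fun w => g x (xi w) 0 i).
Proof.
apply: (measurableT_comp (measurable_coord i) (g := fun w => g x (xi w) : V)).
apply: (measurableT_comp mg (g := fun w => (x : V, xi w))).
by apply: measurable_fun_pair => //; exact: measurable_cst.
Qed.

(** The conditional expectation given the state: [A], [b] and [C] are frozen while [xi] is averaged
    out, then the state is integrated. *)
Let le_step_mean k (h : T * Xi -> R) (A C : T -> R) (b : T -> 'rV[R]_d) (K : T -> R) :
  measurable_fun setT h -> measurable_fun setT K -> (forall z, 0 <= h z) ->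
  (forall s, 0 <= C s) ->
  (forall s v,
    h (s, v) <= A s + dotv (b s) (g (point s) v - grad f (point s))
      + C s * norm2 (g (point s) v - grad f (point s)) ^+ 2) ->
  (forall s, A s + C s * sigma ^+ 2 <= K s) ->
  (\int[P]_w (h (S k w, xis k w))%:E <= \int[P]_w (K (S k w))%:E)%E.
Proof.
move=> mh mK h0 C0 hle AK.
apply: (le_integral_markov_step (s0 := (x0, 0) : T) (S := S) xisP mstep) => // s.
apply: (@le_trans _ _ (A s + C s * sigma ^+ 2)%:E); last by rewrite lee_fin.
apply: (@ge0_integral_le_quadratic _ _ _ _ P (fun w => g (point s) (xi w))
  (grad f (point s)) _ _ _ _ _ _ _ (b s)) => //.
by apply: measurableT_comp => //; exact: measurableT_comp (pair1_measurable s) _.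
Qed.

(** The fixed point of [M = beta M + (G ^+ 2 + sigma ^+ 2) / (1 - beta)], the recursion for the
    second moment of [u]. *)
Let B := (G ^+ 2 + sigma ^+ 2) / (1 - beta) ^+ 2.

Let G2 x : norm2 (grad f x) ^+ 2 <= G ^+ 2.
Proof. by rewrite ler_sqr ?nnegrE ?norm2_ge0// (le_trans _ (gradG x)) ?norm2_ge0. Qed.

(** Convexity gives [|beta u + m|^2 <= beta |u|^2 + |m|^2 / (1 - beta)]; the noise adds
    [sigma ^+ 2], at most [sigma ^+ 2 / (1 - beta)]. *)
Lemma integral_momentum_le k : (\int[P]_w (norm2 (S k w).2 ^+ 2)%:E <= B%:E)%E.
Proof.
have b1 : 0 < 1 - beta by rewrite subr_gt0.
elim: k => [|k IH].
  rewrite /= (_ : norm2 0 = 0); last by rewrite norm2E /dotv big1 ?sqrtr0// => i _; rewrite mxE mul0r.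
  by rewrite expr0n/= integral0 lee_fin divr_ge0 ?addr_ge0 ?sqr_ge0.
pose h (r : T * Xi) := norm2 (step r).2 ^+ 2.
pose K (s : T) := beta * norm2 s.2 ^+ 2 + (G ^+ 2 + sigma ^+ 2) / (1 - beta).
have mu2 : measurable_fun setT (fun s : T => norm2 (s.2 : 'rV[R]_d) ^+ 2).
  exact: (measurableT_comp mnorm2 measurable_snd).
apply: (@le_trans _ _ (\int[P]_w (K (S k w))%:E)%E).
  apply: (@le_step_mean k h
    (fun s => norm2 (beta *: s.2 + grad f (point s)) ^+ 2) (fun=> 1)
    (fun s => 2 *: (beta *: s.2 + grad f (point s))) K) => //.
  - by apply: (measurableT_comp mnorm2); exact: measurableT_comp mstep.
  - apply: measurable_funD; last exact: measurable_cst.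
    by apply: measurable_funM => //; exact: measurable_cst.
  - by move=> z; exact: sqr_ge0.
  - move=> [z u] v; rewrite /h /step /chain_step/= -/(point (z, u)).
    set Y := g _ v - grad f _.
    have -> : g (point (z, u)) v = grad f (point (z, u)) + Y.
      by rewrite /Y addrCA subrr addr0.
    rewrite addrA; move: Y (beta *: u + _) => Y M.
    rewrite !norm2_sqr !dotvDl !dotvDr dotvZl (dotvC Y M); lra.
  - move=> [z u]; rewrite /K/= mul1r; set m := grad f _.
    (* This square, times [beta], is the convexity defect after multiplication by [1 - beta]. *)
    have := dotvv_ge0 ((1 - beta) *: u + (- 1) *: m).
    have := G2 (point (z, u)); rewrite -/m.
    rewrite !norm2_sqr !(dotvDl, dotvDr, dotvZl, dotvZr) (dotvC m u).
    move: (dotv u u) (dotv u m) (dotv m m) => U D M MG H.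
    rewrite -subr_ge0 -(pmulr_rge0 _ b1).
    set X := (X in 0 <= X); set H' := (X in 0 <= X) in H.
    have -> : X = beta * H' + (G ^+ 2 - M) + beta * sigma ^+ 2.
      by rewrite /X /H'; field; rewrite gt_eqF.
    apply: addr_ge0; last exact: mulr_ge0 (sqr_ge0 _).
    by apply: addr_ge0; [exact: mulr_ge0|rewrite subr_ge0].
have B0 : 0 <= G ^+ 2 + sigma ^+ 2 by rewrite addr_ge0 ?sqr_ge0.
rewrite ge0_integral_affine//; first last.
- by rewrite divr_ge0// ltW.
- by move=> w; exact: sqr_ge0.
- exact: (measurableT_comp mu2).
apply: (@le_trans _ _ (beta%:E * B%:E + ((G ^+ 2 + sigma ^+ 2) / (1 - beta))%:E)%E).
  by rewrite leeD2r// lee_wpmul2l// lee_fin.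
rewrite -EFinM -EFinD lee_fin /B le_eqVlt; apply/orP; left; apply/eqP.
by field; rewrite gt_eqF.
Qed.

(** The descent inequality at [z], sorted by degree in the centred noise [y] to fit [le_step_mean];
    [a / 2] times the squared gradient is added on both sides so that it survives to the
    telescoping. *)
Let phi_step (z u v : 'rV[R]_d) (x := z - (beta * q * a) *: u)
    (y := v - grad f x) :
  phi (z - a *: v) + a / 2 * norm2 (grad f x) ^+ 2 <=
  phi z - a * dotv (grad f z) (grad f x)
    + (L * a ^+ 2 + a) / 2 * norm2 (grad f x) ^+ 2
    + dotv ((L * a ^+ 2) *: grad f x - a *: grad f z) y
    + L * a ^+ 2 / 2 * norm2 y ^+ 2.
Proof.
have := smooth_le_quadratic z ((- a) *: v) f_smooth.
rewrite /phi -(scaleNr a v).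
have vE : v = grad f x + y by rewrite /y addrCA subrr addr0.
move: (grad f x) (grad f z) y vE => M Z Y ->.
rewrite -(scaleNr a Z).
rewrite !norm2_sqr !(dotvDl, dotvDr, dotvZl, dotvZr) (dotvC Y M) => H.
lra.
Qed.

(** Replacing [grad f z] by [grad f x] costs a product of [beta |u|] and [|q| |grad f x|]. Young
    splits it, and [a_small] absorbs every squared-gradient term. *)
Let phi_drift (z u : 'rV[R]_d) (x := z - (beta * q * a) *: u) :
  phi z - a * dotv (grad f z) (grad f x)
    + (L * a ^+ 2 + a) / 2 * norm2 (grad f x) ^+ 2
    + L * a ^+ 2 / 2 * sigma ^+ 2 <=
  phi z + (L * a ^+ 2 * beta ^+ 2 / 2 * norm2 u ^+ 2 + L * a ^+ 2 * sigma ^+ 2 / 2).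
Proof.
have := f_smooth.2 z x; rewrite /x addrAC subrr add0r -scaleNr norm2Z normrN.
rewrite scaleNr -/x => Dle.
have := dotv_le_norm2 (grad f x - grad f z) (grad f x).
have -> : dotv (grad f x - grad f z) (grad f x) =
    norm2 (grad f x) ^+ 2 - dotv (grad f z) (grad f x).
  by rewrite dotvDl -scaleN1r dotvZl mulN1r -norm2_sqr.
move=> CS.
have n0 := norm2_ge0 (grad f x); have u0 := norm2_ge0 u.
have CS' := le_trans CS (ler_wpM2r n0 Dle).
have cE : `|beta * q * a| = beta * `|q| * a.
  by rewrite 2!normrM (ger0_norm beta_ge0) (gtr0_norm a_gt0).
rewrite cE in CS'.
have q2 : `|q| ^+ 2 = q ^+ 2 by rewrite real_normK ?num_real.
have := a_small; rewrite -q2 => h.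
move: (dotv _ _) (norm2 (grad f x)) (norm2 u) `|q| (phi z) CS' n0 u0 h (normr_ge0 q)
  => D M U r p CS' n0 u0 h r0.
(* Three inputs for [lra]: the step size condition times [a * M ^+ 2], the Cauchy-Schwarz bound
   times [a], and Young's inequality as a square. *)
have := ler_wpM2r (mulr_ge0 (ltW a_gt0) (sqr_ge0 M)) h.
have := ler_wpM2l (ltW a_gt0) CS'.
have := mulr_ge0 (mulr_ge0 (ltW L_gt0) (sqr_ge0 a)) (sqr_ge0 (beta * U - r * M)).
lra.
Qed.

Let D := L * a ^+ 2 * beta ^+ 2 / 2 * B + L * a ^+ 2 * sigma ^+ 2 / 2.

Let La2_ge0 : 0 <= L * a ^+ 2 := mulr_ge0 (ltW L_gt0) (sqr_ge0 a).

Let mphiS k : measurable_fun setT (fun w => phi (S k w).1).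
Proof.
exact: (measurableT_comp mphi (measurableT_comp measurable_fst (measurable_funPT (S k)))).
Qed.

Let mgradS k : measurable_fun setT (fun w => norm2 (grad f (point (S k w))) ^+ 2).
Proof.
exact: (measurableT_comp mgrad2 (measurableT_comp mpoint (measurable_funPT (S k)))).
Qed.

Let mmomS k : measurable_fun setT (fun w => norm2 (S k w).2 ^+ 2).
Proof.
exact: (measurableT_comp mnorm2 (measurableT_comp measurable_snd (measurable_funPT (S k)))).
Qed.

Lemma integral_descent_step k :
  (\int[P]_w (phi (S k.+1 w).1)%:E
     + (a / 2)%:E * \int[P]_w (norm2 (grad f (point (S k w))) ^+ 2)%:E
   <= \int[P]_w (phi (S k w).1)%:E + D%:E)%E.
Proof.
have a2_ge0 : 0 <= a / 2 by rewrite divr_ge0// ltW.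
pose h (r : T * Xi) := phi (step r).1 + a / 2 * norm2 (grad f (point r.1)) ^+ 2.
pose K (s : T) := phi s.1
  + (L * a ^+ 2 * beta ^+ 2 / 2 * norm2 s.2 ^+ 2 + L * a ^+ 2 * sigma ^+ 2 / 2).
have mgr : measurable_fun setT (fun r : T * Xi => norm2 (grad f (point r.1)) ^+ 2).
  exact: (measurableT_comp mgrad2 (measurableT_comp mpoint measurable_fst)).
have mu2 : measurable_fun setT (fun s : T => norm2 (s.2 : 'rV[R]_d) ^+ 2).
  exact: (measurableT_comp mnorm2 measurable_snd).
have main : (\int[P]_w (h (S k w, xis k w))%:E <= \int[P]_w (K (S k w))%:E)%E.
  apply: (@le_step_mean k h
    (fun s => phi s.1 - a * dotv (grad f s.1) (grad f (point s))
       + (L * a ^+ 2 + a) / 2 * norm2 (grad f (point s)) ^+ 2)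
    (fun=> L * a ^+ 2 / 2)
    (fun s => (L * a ^+ 2) *: grad f (point s) - a *: grad f s.1) K).
  - apply: measurable_funD; last by apply: measurable_funM => //; exact: measurable_cst.
    exact: (measurableT_comp mphi (measurableT_comp measurable_fst mstep)).
  - apply: measurable_funD; first exact: (measurableT_comp mphi measurable_fst).
    apply: measurable_funD; last exact: measurable_cst.
    by apply: measurable_funM => //; exact: measurable_cst.
  - by move=> r; rewrite /h addr_ge0// mulr_ge0// sqr_ge0.
  - by move=> _; rewrite divr_ge0.
  - by move=> [z u] v; exact: (phi_step z u (g (point (z, u)) v)).
  - by move=> [z u]; exact: (phi_drift z u).
have phiE_ge0 j w : (0 <= (phi (S j w).1)%:E)%E by rewrite lee_fin.
have c1 : 0 <= L * a ^+ 2 * beta ^+ 2 / 2.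
  by rewrite divr_ge0// mulr_ge0// sqr_ge0.
have c2 : 0 <= L * a ^+ 2 * sigma ^+ 2 / 2.
  by rewrite divr_ge0// mulr_ge0// sqr_ge0.
have lhsE : (\int[P]_w (h (S k w, xis k w))%:E =
    \int[P]_w (phi (S k.+1 w).1)%:E
     + (a / 2)%:E * \int[P]_w (norm2 (grad f (point (S k w))) ^+ 2)%:E)%E.
  have := ge0_integral_affine P (mgradS k) (fun w => sqr_ge0 _) a2_ge0 (lexx 0).
  rewrite adde0 => <-; rewrite -ge0_integralD//.
  - by apply: eq_integral => w _; rewrite -EFinD addr0.
  - exact/measurable_EFinP.
  - by move=> w _; rewrite lee_fin addr0 mulr_ge0// sqr_ge0.
  - apply/measurable_EFinP/measurable_funD; last exact: measurable_cst.
    by apply: measurable_funM => //; exact: measurable_cst.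
have rhsE : (\int[P]_w (K (S k w))%:E = \int[P]_w (phi (S k w).1)%:E +
    ((L * a ^+ 2 * beta ^+ 2 / 2)%:E * \int[P]_w (norm2 (S k w).2 ^+ 2)%:E
     + (L * a ^+ 2 * sigma ^+ 2 / 2)%:E))%E.
  rewrite -ge0_integral_affine//; last by move=> w; exact: sqr_ge0.
  rewrite -ge0_integralD//.
  - exact/measurable_EFinP.
  - by move=> w _; rewrite lee_fin addr_ge0// mulr_ge0// sqr_ge0.
  - apply/measurable_EFinP/measurable_funD; last exact: measurable_cst.
    by apply: measurable_funM => //; exact: measurable_cst.
rewrite lhsE rhsE in main; apply: (le_trans main).
rewrite leeD2l// /D EFinD leeD2r// [leRHS]EFinM lee_wpmul2l ?lee_fin//.
exact: integral_momentum_le.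
Qed.

(** By contradiction: if every term exceeded the bound, the sum over [n.+1] steps would exceed what
    the telescoped descent allows. *)
Lemma exists_integral_grad_le n : exists2 k, (k < n.+1)%N &
  (\int[P]_w (norm2 (grad f (chain_point a beta q
     (chain g a beta q x0 (fun j => xis j w) k))) ^+ 2)%:E
   <= (2 / (a * (n%:R + 1)) * (phi x0 + (n%:R + 1) * D))%:E)%E.
Proof.
pose I k := (\int[P]_w (norm2 (grad f (point (S k w))) ^+ 2)%:E)%E.
(* The gradient bound [G] makes each expectation finite, so the sum can be handled in the reals. *)
have I_fin k : I k = (fine (I k))%:E.
  rewrite fineK// ge0_fin_numE; last by apply: integral_ge0 => w _; rewrite lee_fin sqr_ge0.
  apply: (@le_lt_trans _ _ (\int[P]_w (cst (G ^+ 2)%:E w))%E); last first.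
    by rewrite integral_cst// [X in (_ * X)%E]probability_setT mule1 ltry.
  apply: ge0_le_integral => //.
  - by move=> w _; rewrite lee_fin sqr_ge0.
  - exact/measurable_EFinP.
  - by move=> w _; rewrite lee_fin.
have sum_le m : (\int[P]_w (phi (S m w).1)%:E + (a / 2 * \sum_(k < m) fine (I k))%:E
    <= (phi x0 + m%:R * D)%:E)%E.
  elim: m => [|m IH].
    rewrite big_ord0 mulr0 mul0r adde0 addr0 /=.
    by rewrite integral_cst// [X in (_ * X)%E]probability_setT mule1.
  have := integral_descent_step m; rewrite -/(I m) I_fin -EFinM => H.
  rewrite big_ord_recr mulrDr [X in X%:E]addrC EFinD addeA.
  apply: le_trans (leeD2r _ H) _; rewrite addeAC -(natr1 m) mulrDl mul1r addrA.
  by rewrite [leRHS]EFinD leeD2r.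
have n1 : 0 < n%:R + 1 :> R by rewrite ltr_wpDl.
apply/not_exists2P => H.
have : phi x0 + (n%:R + 1) * D < a / 2 * \sum_(k < n.+1) fine (I k).
  rewrite mulr_sumr.
  rewrite (_ : phi x0 + _ = \sum_(k < n.+1) (phi x0 + (n%:R + 1) * D) / (n%:R + 1)); last first.
    by rewrite natr1 sumr_const card_ord -[RHS]mulr_natr divfK// pnatr_eq0.
  apply: ltr_sum => [|k _]; first by apply/hasP; exists ord0 => //; rewrite mem_index_enum.
  have [|/negP] := H k; first by move=> /negP; rewrite ltn_ord.
  rewrite -/(I k) I_fin lee_fin -ltNge.
  set Q := phi x0 + _; have -> : Q / (n%:R + 1) = a / 2 * (2 / (a * (n%:R + 1)) * Q).
    by field; rewrite !gt_eqF.
  by rewrite ltr_pM2l// divr_gt0.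
apply/negP; rewrite -leNgt.
have := sum_le n.+1; rewrite -(natr1 n) -lee_fin; apply: le_trans.
by rewrite leeDr//; apply: integral_ge0 => w _; rewrite lee_fin.
Qed.

End descent.

(** * Choice of the step size and the final rate *)

Theorem theorem2 (R : realType) (d : nat)
    (dO dX : measure_display)
    (Omega : measurableType dO) (Xi : measurableType dX)
    (P : probability Omega R)
    (xi : {RV P >-> Xi}) (xis : nat -> {RV P >-> Xi})
    (f : 'rV[R]_d -> R) (g : 'rV[R]_d -> Xi -> 'rV[R]_d)
    (L sigma G beta s C : R) (t : nat) (x0 : 'rV[R]_d)
    (hL : 0 < L) (hf : smooth L f) (hlb : has_lbound (range f))
    (hg : measurable_fun [set: borel_rV R d * Xi]
            (fun z : borel_rV R d * Xi => g z.1 z.2 : borel_rV R d))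
    (hxi : independent_copies xi xis)
    (hmean : forall (x : 'rV[R]_d) (i : 'I_d),
       ('E_P[fun w => (g x (xi w) 0 i)%R] = (grad f x 0 i)%R%:E)%E)
    (hvar : forall x : 'rV[R]_d,
       ('E_P[fun w => (norm2 (g x (xi w) - grad f x) ^+ 2)%R]
         <= (sigma ^+ 2)%R%:E)%E)
    (hG : forall x : 'rV[R]_d, norm2 (grad f x) <= G)
    (hbeta0 : 0 <= beta) (hbeta1 : beta < 1) (hs : 0 <= s) (hC : 0 < C) :
  let fstar := inf (range f) in
  let alpha :=
    Num.min ((1 - beta) / (2 * L * (1 + ((1 - beta) * s - 1) ^+ 2)))
            (C / Num.sqrt (t%:R + 1)) in
  let Lambda :=
    Num.max (2 * L * (1 + ((1 - beta) * s - 1) ^+ 2) / (1 - beta))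
            (Num.sqrt (t%:R + 1) / C) in
  let x := fun (k : nat) (w : Omega) =>
    sum_iterate alpha beta s g x0 (fun j => xis j w) k in
  (\big[Order.min/+oo]_(k < t.+1) 'E_P[fun w => (norm2 (grad f (x k w)) ^+ 2)%R]
   <= (2 * (f x0 - fstar) * (1 - beta) / (t%:R + 1) * Lambda
       + C / Num.sqrt (t%:R + 1)
         * ((L * beta ^+ 2 * (G ^+ 2 + sigma ^+ 2)
             + L * sigma ^+ 2 * (1 - beta) ^+ 2)
            / (1 - beta) ^+ 3))%R%:E)%E.
Proof.
lazy zeta; set fstar := inf _; set alpha := Num.min _ _; set Lambda := Num.max _ _.
set x := fun (k : nat) (w : Omega) => sum_iterate alpha beta s g x0 _ k.
pose q := (1 - beta) * s - 1; pose a := alpha / (1 - beta).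
have b1 : 0 < 1 - beta by rewrite subr_gt0.
have q1 : 0 < 1 + q ^+ 2 by rewrite ltr_wpDr ?sqr_ge0.
have t1 : 0 < t%:R + 1 :> R by rewrite ltr_wpDl.
have st : 0 < Num.sqrt (t%:R + 1 : R) by rewrite sqrtr_gt0.
have Lq : 0 < 2 * L * (1 + q ^+ 2) by rewrite !mulr_gt0.
have alpha_gt0 : 0 < alpha by rewrite lt_min !divr_gt0.
(* Inversion reverses the order of positive numbers, turning the minimum into the maximum of the
   inverses. *)
have LambdaE : Lambda = alpha^-1.
  rewrite /Lambda /alpha -/q; have [le|lt] := leP ((1 - beta) / _) (C / _).
    rewrite invf_div max_l// -[leLHS]invf_div -[leRHS]invf_div.
    by rewrite lef_pV2// posrE divr_gt0.
  rewrite invf_div max_r// -[leLHS]invf_div -[leRHS]invf_div.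
  by rewrite lef_pV2 ?ltW// posrE divr_gt0.
have a_gt0 : 0 < a by rewrite divr_gt0.
have alphaE : alpha = (1 - beta) * a by rewrite /a mulrCA divff ?mulr1// gt_eqF.
(* The first entry of the minimum even yields the bound [1 / 2]. *)
have a_small : L * a * (1 + q ^+ 2) <= 1.
  have : alpha <= (1 - beta) / (2 * L * (1 + q ^+ 2)) by rewrite ge_min lexx.
  rewrite ler_pdivlMr// alphaE -[leLHS]mulrA ger_pMr// => H.
  have := mulr_gt0 (mulr_gt0 hL a_gt0) q1; lra.
have alpha_le : alpha <= C / Num.sqrt (t%:R + 1) by rewrite ge_min lexx orbT.
have [k kt Hk] := exists_integral_grad_le x0 hL hf hlb hg hxi hmean hvar hG hbeta0
  hbeta1 a_gt0 a_small t.
have xE w : x k w = chain_point a beta q (chain g a beta q x0 (fun j => xis j w) k).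
  by rewrite /x /sum_iterate alphaE (@sum_state_chain _ _ _ _ _ _ q).
apply: (bigmin_inf (Ordinal kt)) => //=.
rewrite unlock; under eq_integral do rewrite xE.
apply: (le_trans Hk); rewrite lee_fin LambdaE.
set W := L * beta ^+ 2 * _ + _.
have W0 : 0 <= W.
  have Lsqr_ge0 r : 0 <= L * r ^+ 2 by rewrite mulr_ge0 ?sqr_ge0// ltW.
  by apply: addr_ge0; apply: mulr_ge0; rewrite ?sqr_ge0// addr_ge0 ?sqr_ge0.
(* Only the noise term, whose factor [W] is nonnegative, uses [alpha <= C / sqrt (t + 1)]; the first
   term keeps the exact [alpha^-1]. *)
apply: (@le_trans _ _ (2 * (f x0 - fstar) * (1 - beta) / (t%:R + 1) * alpha^-1
  + alpha * (W / (1 - beta) ^+ 3))); last first.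
  by rewrite lerD2l ler_wpM2r// divr_ge0// exprn_ge0// ltW.
(* What remains is an identity: [2 / a] times the per-step error [D] equals
   [alpha * W / (1 - beta) ^+ 3]. *)
rewrite le_eqVlt; apply/orP; left; apply/eqP.
rewrite /W /a /fstar; field.
by rewrite !gt_eqF.
Qed.
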